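(* Let $n,k$ be positive integers with $k\geqslant n$, let $m_1,\ldots,m_n$ be nonnegative integers and $M=m_1+\cdots+m_n$. Then $$\sum_{\substack{k_1+\cdots+k_n=k\\ k_j\geqslant 1}}k_1^{m_1}\cdots k_n^{m_n}\frac{B_{2k_1}\cdots B_{2k_n}}{(2k_1)!\cdots(2k_n)!} =\sum_{l=0}^{\min\{T,k\}}\left(\sum_{j=1}^{M+n-2l}\frac{a_{jl}}{2^{M-j+1}}(k-l)^{j-1}\right)\frac{B_{2k-2l}}{(2k-2l)!},$$ where $T=\max\{[(M+n-2)/2],[(n-1)/2]\}$ and $a_{jl}$ are the rational numbers defined in the context.
   Context: $B_i$ are the Bernoulli numbers, $\sum_{i\geqslant0}\frac{B_i}{i!}t^i=\frac{t}{e^t-1}$; $[x]$ is the greatest integer not exceeding $x$. The polynomials $f_{mi}(t)\in\mathbb{Q}[t]$ ($m\geqslant 0$, $0\leqslant i\leqslant m+1$) are defined by $f_{00}(t)=\frac12 t-1$, $f_{01}(t)=1$ and, for $m\geqslant 1$: $f_{m0}(t)=tf_{m-1,0}'(t)$; $f_{m,m+1}(t)=-mf_{m-1,m}(t)$; $f_{mi}(t)=tf'_{m-1,i}(t)+i(1-t)f_{m-1,i}(t)-(i-1)f_{m-1,i-1}(t)$ for $1\leqslant i\leqslant m$. For $m\geqslant 0$ let $A_m(t)$ be the $(m+1)\times(m+1)$ lower triangular matrix with entry $f_{ri}(t)$ in row $r$ ($0\leqslant r\leqslant m$), column $i$ ($1\leqslant i\leqslant r+1$); it is invertible, and $g_{ri}(t)$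 is the entry in row $r$, column $i$ of $A_m(t)^{-1}$ (independent of $m\geqslant r$). Set $f_i(t)=\sum_{i_1+\cdots+i_n=i,\ 0\leqslant i_j\leqslant m_j+1}f_{m_1i_1}(t)\cdots f_{m_ni_n}(t)$ and $F_j(t)=\sum_{i=j}^{M+n}f_i(t)g_{i-1,j}(t)$ for $1\leqslant j\leqslant M+n$; these are even polynomials, and $a_{jl}\in\mathbb{Q}$ denotes the coefficient of $t^{2l}$ in $F_j(t)$. *)

(* Defs.v *)
From mathcomp Require Import all_boot all_order all_algebra.
Set Implicit Arguments.
Unset Strict Implicit.
Unset Printing Implicit Defensive.
Import GRing.Theory Num.Theory.
Local Open Scope ring_scope.

(* A formal power series over rat is given by its sequence of coefficients. *)
Definition fps_mul (a b : nat -> rat) (n : nat) : rat :=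
  \sum_(i < n.+1) a i * b (n - i)%N.

Fixpoint fps_inv_seq (a : nat -> rat) (n : nat) : seq rat :=
  if n is p.+1 then
    let s := fps_inv_seq a p in
    rcons s (((p == 0%N)%:R - \sum_(i < p) s`_i * a (p - i)%N) / a 0%N)
  else [::].

(* The multiplicative inverse of the series a, meaningful when a 0 != 0. *)
Definition fps_inv (a : nat -> rat) (n : nat) : rat := (fps_inv_seq a n.+1)`_n.

(* t / (e^t - 1) is the inverse of (e^t - 1) / t = \sum_n t^n / (n + 1)!,
   so B_1 = - 1/2; see bernoulli_egf and bernoulli_egf_unique below. *)
Definition bernoulli (i : nat) : rat :=
  (i`!)%:R * fps_inv (fun n => (n.+1`!)%:R^-1) i.

Lemma size_fps_inv_seq a n : size (fps_inv_seq a n) = n.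
Proof. by elim: n => //= n IHn; rewrite size_rcons IHn. Qed.

Lemma nth_fps_inv_seq a n i : (i < n)%N -> (fps_inv_seq a n)`_i = fps_inv a i.
Proof.
elim: n => // n IHn; rewrite ltnS leq_eqVlt => /orP[/eqP-> //|lt_in].
by rewrite /= nth_rcons size_fps_inv_seq lt_in IHn.
Qed.

Lemma fps_inv_mul a n : a 0%N != 0 -> fps_mul (fps_inv a) a n = (n == 0%N)%:R.
Proof.
move=> a0; rewrite /fps_mul big_ord_recr /= subnn.
rewrite {2}/fps_inv /= nth_rcons size_fps_inv_seq ltnn eqxx divfK //.
under [X in _ - X]eq_bigr => i _ do rewrite nth_fps_inv_seq //.
by rewrite addrC subrK.
Qed.

Lemma bernoulli_egf n :
  fps_mul (fun i => bernoulli i / (i`!)%:R)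
          (fun i => if i == 0%N then 0 else (i`!)%:R^-1) n = (n == 1%N)%:R.
Proof.
have fact_neq0 i : (i`!)%:R != 0 :> rat by rewrite pnatr_eq0 -lt0n fact_gt0.
rewrite /fps_mul big_ord_recr /= subnn eqxx mulr0 addr0.
case: n => [|n]; first by rewrite big_ord0.
rewrite eqSS -(@fps_inv_mul (fun n => (n.+1`!)%:R^-1)) ?invr_neq0 //.
apply: eq_bigr => i _; rewrite subSn; last by rewrite -ltnS.
by congr (_ * _); rewrite /bernoulli mulrAC mulfV ?mul1r.
Qed.

Lemma bernoulli_egf_unique (b : nat -> rat) :
  (forall n, fps_mul (fun i => b i / (i`!)%:R)
     (fun i => if i == 0%N then 0 else (i`!)%:R^-1) n = (n == 1%N)%:R) ->
  b =1 bernoulli.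
Proof.
have fact_neq0 i : (i`!)%:R != 0 :> rat by rewrite pnatr_eq0 -lt0n fact_gt0.
move=> Hb; elim/ltn_ind => n IHn.
have := Hb n.+1; rewrite -bernoulli_egf /fps_mul !big_ord_recr /=.
rewrite subnn eqxx !mulr0 !addr0 subSnn /= invr1 !mulr1.
under eq_bigr => i _ do rewrite IHn //.
by move/addrI/(mulIf (invr_neq0 (fact_neq0 n))).
Qed.

(* The polynomials f_{mi}, extended by 0 to i > m + 1. *)
Fixpoint fpoly (m i : nat) : {poly rat} :=
  match m with
  | 0 => if i == 0%N then (1 / 2)%:P * 'X - 1 else if i == 1%N then 1 else 0
  | p.+1 =>
      if i == 0%N then 'X * (fpoly p 0)^`()
      else if i == m.+1 then - (m%:R * fpoly p m)
      else if (i <= m)%N then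
        'X * (fpoly p i)^`() + i%:R * (1 - 'X) * fpoly p i
          - (i.-1)%:R * fpoly p i.-1
      else 0
  end.

(* Columns are indexed from 1 in the mathematics and from 0 here. *)
Definition Amx (m : nat) : 'M[{poly rat}]_m.+1 :=
  \matrix_(r, c) if (c <= r)%N then fpoly r c.+1 else 0.

(* g_{ri} is read off A_m^-1 for m = r; see gpolyE for the other m. *)
Definition gpoly (r i : nat) : {poly rat} :=
  invmx (Amx r) ord_max (inord i.-1).

Lemma fpoly_diag m : fpoly m m.+1 = ((-1) ^+ m * (m`!)%:R)%:P.
Proof.
elim: m => [|m IHm]; first by rewrite /= expr0 mul1r.
rewrite [LHS]/= eqxx IHm -polyC_natr -polyCM -polyCN exprS factS natrM.
by rewrite mulN1r mulNr mulrCA.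
Qed.

Lemma Amx_unit m : Amx m \in unitmx.
Proof.
have Atrig : is_trig_mx (Amx m).
  by apply/is_trig_mxP => i j lt_ij; rewrite mxE leqNgt lt_ij.
rewrite unitmxE (det_trig Atrig) unitr_prod //= => i _.
rewrite mxE leqnn fpoly_diag poly_unitE size_polyC coefC eqxx unitfE.
have -> : (-1) ^+ i * (i`!)%:R != 0 :> rat.
  by rewrite mulf_neq0 ?signr_eq0 // pnatr_eq0 -lt0n fact_gt0.
by [].
Qed.

Lemma gpolyE m r i : (r <= m)%N -> (0 < i <= r.+1)%N ->
  invmx (Amx m) (inord r) (inord i.-1) = gpoly r i.
Proof.
move=> le_rm /andP[i_gt0 le_ir].
have lt_ir : (i.-1 < r.+1)%N by rewrite prednK.
have le_SrSm : (r.+1 <= m.+1)%N by [].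
pose v : 'rV[{poly rat}]_m.+1 :=
  \row_c if (c <= r)%N then invmx (Amx r) ord_max (inord c) else 0.
have vA : v *m Amx m = delta_mx 0 (inord r).
  apply/rowP => c; rewrite mxE [RHS]mxE eqxx /=.
  have -> : (c == inord r) = (c == r :> nat) by rewrite -val_eqE /= inordK.
  transitivity (\sum_(s < r.+1) invmx (Amx r) ord_max s * Amx m (inord s) c).
    pose h (s : nat) := invmx (Amx r) ord_max (inord s) * Amx m (inord s) c.
    transitivity (\sum_(s < r.+1) h s); last first.
      by apply: eq_bigr => s _; rewrite /h inord_val.
    rewrite (big_ord_widen m.+1 h le_SrSm) [RHS]big_mkcond.
    apply: eq_bigr => s _; rewrite mxE /h inord_val ltnS.
    by case: ifP; rewrite ?mul0r.
  have [le_cr|lt_rc] := leqP c r; last first.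
    rewrite big1 => [|s _]; first by rewrite gtn_eqF.
    rewrite mxE inordK ?(leq_trans (ltn_ord s)) // leqNgt.
    by rewrite (leq_trans (ltn_ord s)) ?mulr0.
  have /matrixP/(_ ord_max (inord c)) := mulVmx (Amx_unit r).
  rewrite !mxE -val_eqE /= inordK // eq_sym => <-.
  apply: eq_bigr => s _; rewrite !mxE !inordK //.
  by rewrite (leq_trans (ltn_ord s)).
have : v = delta_mx 0 (inord r) *m invmx (Amx m).
  by rewrite -vA mulmxK ?Amx_unit.
rewrite -rowE => /rowP/(_ (inord i.-1)); rewrite !mxE => <-.
by rewrite inordK ?(leq_trans lt_ir) // -ltnS lt_ir.
Qed.

Definition weight (n : nat) (m : 'I_n -> nat) : nat := (\sum_j m j)%N.

(* Each summand i_j is at most i, hence the codomain 'I_i.+1. *)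
Definition fsum (n : nat) (m : 'I_n -> nat) (i : nat) : {poly rat} :=
  \sum_(s : {ffun 'I_n -> 'I_i.+1} |
        ((\sum_j s j)%N == i) && [forall j, (s j <= (m j).+1)%N])
     \prod_j fpoly (m j) (s j).

Definition Fpoly (n : nat) (m : 'I_n -> nat) (j : nat) : {poly rat} :=
  \sum_(j <= i < (weight m + n).+1) fsum m i * gpoly i.-1 j.

Definition acoef (n : nat) (m : 'I_n -> nat) (j l : nat) : rat :=
  (Fpoly m j)`_(2 * l)%N.

(* Truncated subtraction is harmless: for n > 0 it only matters if n = 1 and
   weight m = 0, and then the maximum is 0 whether its first entry is -1 or 0. *)
Definition Tbound (n : nat) (m : 'I_n -> nat) : nat :=
  maxn ((weight m + n - 2) %/ 2) ((n - 1) %/ 2).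

(* Main.v *)
From HB Require Import structures.
Require Import Defs.
From mathcomp Require Import all_boot all_order all_algebra.
From mathcomp Require Import ring zify.
Set Implicit Arguments.
Unset Strict Implicit.
Unset Printing Implicit Defensive.
Import GRing.Theory Num.Theory.
Local Open Scope ring_scope.

(* Let b = t/(e^t - 1), D = t d/dt and E = b + t/2 - 1 = \sum_(k >= 1)
   B_{2k} t^{2k}/(2k)!. Since D b = (1 - t) b - b^2, the f_{mi} are the
   coefficients of D^m E as a polynomial in b, and inverting the triangular
   system gives \prod_j D^{m_j} E = f_0 + \sum_j F_j D^{j-1} b. The theorem
   compares the coefficients of t^{2k}; f_0 has degree at most n < 2k.

   Parity and degree of the F_j are obtained formally. In the variable
   z = b + t/2 one has D z = z - z^2 + t^2/4 and E = z - 1, so all D^m E are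
   even in t and have total degree at most m + 1 in (t, z), with a constant
   leading coefficient in z. Triangularity transfers both properties to the
   F_j. The same equation D z = z - z^2 + t^2/4, read on coefficients, shows
   that the odd Bernoulli numbers beyond B_1 vanish. *)

(** * Coefficients of finite products *)

Lemma coef_prod_ffun (R : comNzRingType) n (p : 'I_n -> {poly R}) i :
  (\prod_j p j)`_i =
  \sum_(s : {ffun 'I_n -> 'I_i.+1} | (\sum_j s j)%N == i)
     \prod_j (p j)`_(s j).
Proof.
(* Degrees above [i] cannot contribute; truncating there makes every factor a sum over the same
   finite type, so the product distributes over functions. *)
have -> : (\prod_j p j)`_i = (\prod_j \poly_(c < i.+1) (p j)`_c)`_i.
  pose K (a b : {poly R}) := forall c, (c <= i)%N -> a`_c = b`_c.
  suff: K (\prod_j p j) (\prod_j \poly_(c < i.+1) (p j)`_c) by apply.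
  apply: (big_ind2 K) => // [a1 a2 b1 b2 Ha Hb c le_ci|j _ c le_ci].
    rewrite !coefM; apply: eq_bigr => l _.
    have := ltn_ord l; rewrite ltnS => le_lc; rewrite Ha ?Hb //.
      exact: leq_trans (leq_subr _ _) le_ci.
    exact: leq_trans le_ci.
  by rewrite coef_poly ltnS le_ci.
under eq_bigr => j _ do rewrite poly_def.
rewrite bigA_distr_bigA coef_sum [RHS]big_mkcond; apply: eq_bigr => s _.
rewrite scaler_prod prodrXr coefZ coefXn eq_sym.
by case: eqP; rewrite ?mulr1 ?mulr0.
Qed.

(** * The derivation t d/dt on Q[t] and its extension to Q[t][z] *)

Definition theta (p : {poly rat}) : {poly rat} := 'X * p^`().

Lemma coef_theta p c : (theta p)`_c = c%:R * p`_c.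
Proof.
rewrite /theta coefXM; case: c => [|c] /=; first by rewrite mul0r.
by rewrite coef_deriv mulr_natl.
Qed.

Lemma thetaM p q : theta (p * q) = theta p * q + p * theta q.
Proof. rewrite /theta derivM; ring. Qed.

Lemma theta_is_linear : linear theta.
Proof. by move=> a p q; rewrite /theta derivD derivZ mulrDr scalerAr. Qed.

HB.instance Definition _ :=
  GRing.isLinear.Build rat {poly rat} {poly rat} *:%R theta theta_is_linear.

Lemma theta_half_X : theta ((1 / 2)%:P * 'X) = (1 / 2)%:P * 'X.
Proof. by rewrite /theta derivM derivC derivX; ring. Qed.

Lemma double_half_X : 'X = (1 / 2)%:P * 'X *+ 2 :> {poly rat}.
Proof. by rewrite -mulrnAl -polyCMn (_ : 1 / 2 *+ 2 = 1) ?polyC1 ?mul1r. Qed.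

Lemma sqr_half_X : (1 / 4%:R) *: 'X^2 = ((1 / 2)%:P * 'X) ^+ 2 :> {poly rat}.
Proof. by rewrite -mul_polyC exprMn -polyC_exp; congr (_%:P * _). Qed.

Lemma coef_iter_theta m p c : (iter m theta p)`_c = c%:R ^+ m * p`_c.
Proof.
elim: m => [|m IHm]; first by rewrite mul1r.
by rewrite iterS coef_theta IHm mulrA -exprS.
Qed.

Lemma map_thetaM (P Q : {poly {poly rat}}) :
  map_poly theta (P * Q) = map_poly theta P * Q + P * map_poly theta Q.
Proof.
apply/polyP => i; rewrite coefD coef_map /= !coefM raddf_sum /= -big_split /=.
by apply: eq_bigr => j _; rewrite !coef_map thetaM.
Qed.

Lemma map_thetaX : map_poly theta 'X = 0.
Proof.
apply/polyP => i; rewrite coef_map coefX coef0 /= /theta -polyC_natr derivC.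
by rewrite mulr0.
Qed.

(** Chain rule: both the coefficients of [P] and the argument [p] depend on t. *)
Lemma theta_horner (P : {poly {poly rat}}) p :
  theta P.[p] = (map_poly theta P).[p] + P^`().[p] * theta p.
Proof.
elim/poly_ind: P => [|P c IHP].
  by rewrite raddf0 deriv0 !horner0 raddf0 mul0r addr0.
have mapC : map_poly theta c%:P = (theta c)%:P by rewrite map_polyC.
rewrite hornerMXaddC raddfD /= thetaM IHP derivD derivM derivX derivC addr0.
rewrite mulr1 raddfD /= mapC map_thetaM map_thetaX mulr0 addr0.
rewrite !(hornerD, hornerMX, hornerC).
ring.
Qed.

(* The derivation of Q[t][z] that extends t d/dt by z |-> z - z^2 + t^2/4, the
   equation satisfied by t/2 * coth (t/2) = t/(e^t - 1) + t/2. *)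
Definition zder (P : {poly {poly rat}}) : {poly {poly rat}} :=
  map_poly theta P + ('X - 'X^2 + ((1 / 4%:R) *: 'X^2)%:P) * P^`().

Lemma zder_is_zmod_morphism : zmod_morphism zder.
Proof. by move=> P Q; rewrite /zder derivB !raddfB /=; ring. Qed.

HB.instance Definition _ := GRing.isZmodMorphism.Build
  {poly {poly rat}} {poly {poly rat}} zder zder_is_zmod_morphism.

Lemma zderM P Q : zder (P * Q) = zder P * Q + P * zder Q.
Proof. by rewrite /zder map_thetaM derivM; ring. Qed.

Lemma zderC p : zder p%:P = (theta p)%:P.
Proof. by rewrite /zder map_polyC derivC mulr0 addr0. Qed.

Lemma zderXn P i : zder (P ^+ i) = i%:R * P ^+ i.-1 * zder P.
Proof.
elim: i => [|i IHi].
  by rewrite expr0 (zderC 1) /theta derivC mulr0 !mul0r.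
rewrite exprS zderM IHi; case: i {IHi} => [|i] /=; first by rewrite expr0; ring.
by rewrite exprS -[i.+2%:R]natr1; ring.
Qed.

Lemma coef_zder P i :
  (zder P)`_i = theta P`_i + i%:R * P`_i - i.-1%:R * P`_i.-1
                + (1 / 4%:R) *: 'X^2 * (i.+1%:R * P`_i.+1).
Proof.
rewrite /zder coefD coef_map /= mulrDl mulrBl coefD coefB coefXM coefXnM coefCM.
rewrite !coef_deriv -[P`__ *+ i.+1]mulr_natl.
case: i => [|[|i]] /=; rewrite ?subSS ?subn0 -?[P`__ *+ _]mulr_natl; ring.
Qed.

(** * Degree and parity of the D^m E in Q[t][z] *)

Definition zgen m : {poly {poly rat}} := iter m zder ('X - 1).

(* Joint encoding of "P has total degree at most d in (t, z)" and
   "P is even in t"; P`_i`_k is the coefficient of z^i t^k. *)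
Definition even_deg_le d (P : {poly {poly rat}}) :=
  forall i k, (d < i + k)%N || odd k -> P`_i`_k = 0.

Lemma even_deg_leM d e P Q :
  even_deg_le d P -> even_deg_le e Q -> even_deg_le (d + e) (P * Q).
Proof.
move=> HP HQ i k Hik; rewrite coefM coef_sum big1 // => [[a ltai] _] /=.
rewrite coefM big1 // => [[c ltck] _] /=.
have [H|/negbTE H] := boolP ((d < a + c)%N || odd c).
  by rewrite HP ?mul0r.
rewrite HQ ?mulr0 //; lia.
Qed.

(** t d/dt only rescales monomials, while d/dz lowers the degree by one before the multiplication by
    z - z^2 + t^2/4, which has degree 2 and is even in t. *)
Lemma even_deg_le_zder d P : even_deg_le d P -> even_deg_le d.+1 (zder P).
Proof.
move=> HP i k Hik; rewrite coef_zder coefD coefB coefD coef_theta.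
have -> : (i.-1%:R * P`_i.-1)`_k = 0.
  case: i Hik => [|i] Hik /=; first by rewrite mul0r coef0.
  by rewrite -polyC_natr coefCM HP ?mulr0 //; lia.
rewrite -scalerAl coefZ coefXnM -!polyC_natr !coefCM.
rewrite HP ?mulr0 ?subr0 ?addr0 ?add0r; last by lia.
by case: ifP => Hk; rewrite ?HP ?mulr0 //; lia.
Qed.

Lemma even_deg_le_zgen m : even_deg_le m.+1 (zgen m).
Proof.
elim: m => [|m IHm]; last exact: even_deg_le_zder.
move=> i k Hik; rewrite coefB coefX coef1 coefB.
by case: i k Hik => [|[|i]] [|[|k]] //=; rewrite ?coef0 ?coef1 /= ?subr0.
Qed.

Lemma weightDn n (m : 'I_n -> nat) :
  (weight m + n = \sum_(j < n) (m j).+1)%N.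
Proof.
under [RHS]eq_bigr => j _ do rewrite -addn1.
by rewrite big_split /= sum1_card card_ord.
Qed.

Lemma even_deg_le_prod n (m : 'I_n -> nat) :
  even_deg_le (weight m + n) (\prod_j zgen (m j)).
Proof.
rewrite weightDn; apply: (big_ind2 even_deg_le) => [||j _].
- by move=> i k; rewrite coef1; case: i k => [|i] [|k] //=;
    rewrite ?coef0 ?coef1.
- by move=> ? ? ? ? ? ?; exact: even_deg_leM.
- exact: even_deg_le_zgen.
Qed.

(** Only the term -z^2 d/dz of [zder] raises the degree in z, so the step from m to m + 1 multiplies
    the leading coefficient by -(m + 1). *)
Lemma lead_zgen m : (zgen m)`_m.+1 = ((-1) ^+ m * m`!%:R)%:P.
Proof.
have zgen_gt p i : (p.+1 < i)%N -> (zgen p)`_i = 0.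
  move=> lt_pi; apply/polyP => k; rewrite coef0.
  by apply: even_deg_le_zgen; lia.
elim: m => [|m IHm]; first by rewrite coefB coefX coef1 subr0 expr0 mul1r.
rewrite -[zgen m.+1]/(zder (zgen m)) coef_zder /= (zgen_gt _ m.+2) //.
rewrite (zgen_gt _ m.+3) // raddf0 !mulr0 !addr0 add0r IHm.
by rewrite -polyC_natr -polyCM -polyCN exprS factS natrM; congr _%:P; ring.
Qed.

Lemma even_deg_le_expansion N d (h : {poly rat}) (F : nat -> {poly rat}) :
  even_deg_le d (h%:P + \sum_(1 <= j < N.+1) F j *: zgen j.-1) ->
  (forall k, (d < k)%N || odd k -> h`_k = 0) /\
  (forall j k, (0 < j <= N)%N -> (d < j + k)%N || odd k -> (F j)`_k = 0).
Proof.
elim: N => [|N IHN].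
  rewrite big_geq // addr0 => Hh; split=> [k Hk|j k]; last by lia.
  by have := Hh 0%N k Hk; rewrite coefC.
rewrite big_nat_recr //= addrA; set Q := _ + \sum_(_ <= _ < _) _ => HQ.
(* Only the last term reaches z^(N+1), and its leading coefficient there is a nonzero constant, so
   [F N.+1] inherits the constraints; that term can then be removed. *)
have FN k : (d < N.+1 + k)%N || odd k -> (F N.+1)`_k = 0.
  move/(HQ N.+1 k); rewrite coefD coefZ lead_zgen mulrC mul_polyC coefD coefZ.
  have -> : Q`_N.+1 = 0.
    rewrite coefD coefC add0r coef_sum big_nat big1 // => j /andP[j0 jN].
    rewrite coefZ; suff -> : (zgen j.-1)`_N.+1 = 0 by rewrite mulr0.
    apply/polyP => c; rewrite coef0.
    by apply: even_deg_le_zgen; rewrite prednK //; lia.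
  rewrite coef0 add0r => /eqP; rewrite mulf_eq0 mulf_eq0 signr_eq0 /=.
  by rewrite pnatr_eq0 -leqn0 leqNgt fact_gt0 => /eqP.
have [] := IHN.
  move=> i k Hik; have := HQ i k Hik; rewrite -/Q coefD coefZ coefD.
  suff -> : (F N.+1 * (zgen N)`_i)`_k = 0 by rewrite addr0.
  rewrite coefM big1 // => [[c ltck] _] /=.
  have [H|/negbTE H] := boolP ((d < N.+1 + c)%N || odd c).
    by rewrite FN ?mul0r.
  rewrite even_deg_le_zgen ?mulr0 //; lia.
move=> Hh HF; split=> // j k /andP[j0]; rewrite leq_eqVlt.
by case/orP=> [/eqP-> /FN //|jN]; apply: HF; rewrite j0.
Qed.

(** * Passing between the powers of b and the D^m E *)

Lemma fpoly_gt m i : (m.+1 < i)%N -> fpoly m i = 0.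
Proof.
case: m i => [|m] i lt_mi; first by case: i lt_mi => [|[|i]].
by rewrite /= !gtn_eqF 1?leqNgt ?(ltnW lt_mi) //; lia.
Qed.

(** As [fpoly m i] vanishes for i > m + 1, the interior recurrence also yields the boundary cases of
    the definition. *)
Lemma fpolyS m i :
  fpoly m.+1 i = theta (fpoly m i) + i%:R * (1 - 'X) * fpoly m i
                 - i.-1%:R * fpoly m i.-1.
Proof.
have [->|i0] := eqVneq i 0%N; first by rewrite /= !mul0r addr0 subr0.
have [->|im] := eqVneq i m.+2.
  by rewrite /= eqxx (@fpoly_gt m m.+2) // raddf0 mulr0 addr0 add0r.
rewrite /= (negPf i0) (negPf im); case: leqP => // lt_mi.
by rewrite !fpoly_gt ?raddf0 ?mulr0 ?subr0 ?addr0 //; lia.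
Qed.

Lemma fpoly_0 m : fpoly m 0 = (1 / 2)%:P * 'X - (m == 0%N)%:R.
Proof.
elim: m => // m IHm; rewrite fpolyS IHm /= !mul0r addr0 subr0 subr0.
by rewrite raddfB /= /theta derivM derivC derivX -polyC_natr derivC; ring.
Qed.

(* The series t/(e^t - 1), in terms of the variable z = t/(e^t - 1) + t/2. *)
Definition xvar : {poly {poly rat}} := 'X - ((1 / 2)%:P * 'X)%:P.

Lemma zder_xvar : zder xvar = (1 - 'X)%:P * xvar - xvar ^+ 2.
Proof.
rewrite /xvar raddfB /= zderC theta_half_X /zder map_thetaX derivX mulr1.
have -> : 1 - 'X = 1 - (1 / 2)%:P * 'X *+ 2 :> {poly rat}.
  by rewrite -double_half_X.
rewrite sqr_half_X add0r polyCB polyCMn polyC_exp polyC1; ring.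
Qed.

(** D(f b^i) = (D f + i(1 - t) f) b^i - i f b^(i+1); collecting powers of b gives the recurrence of
    the f_{mi}. *)
Lemma zgenE m : zgen m = \sum_(i < m.+2) fpoly m i *: xvar ^+ i.
Proof.
elim: m => [|m IHm].
  rewrite !big_ord_recl big_ord0 /= expr0 expr1 scale1r addr0 /xvar.
  by rewrite -mul_polyC mulr1 polyCB polyC1; ring.
rewrite -[zgen m.+1]/(zder (zgen m)) IHm raddf_sum.
transitivity (\sum_(i < m.+2)
    ((theta (fpoly m i) + i%:R * (1 - 'X) * fpoly m i) *: xvar ^+ i
     - (i%:R * fpoly m i) *: xvar ^+ i.+1)).
  apply: eq_bigr => [[i lt_im] _] /=; rewrite -!mul_polyC zderM zderC zderXn.
  rewrite zder_xvar; case: i {lt_im} => [|i] /=.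
    by rewrite !mul0r addr0; ring.
  by rewrite !exprS; ring.
rewrite sumrB; symmetry.
under eq_bigr => i _ do rewrite fpolyS scalerBl.
rewrite sumrB; congr (_ - _).
  rewrite big_ord_recr /= (@fpoly_gt m m.+2) // raddf0 mulr0 addr0 scale0r.
  by rewrite addr0.
by rewrite big_ord_recl /= mul0r scale0r add0r.
Qed.

(** Without their constant terms, the [zgen j] are the rows of [Amx r] applied to b, ..., b^(r+1);
    the last row of the inverse recovers b^(r+1). *)
Lemma xvar_exp r :
  xvar ^+ r.+1 =
  \sum_(1 <= j < r.+2) gpoly r j *: (zgen j.-1 - (fpoly j.-1 0)%:P).
Proof.
rewrite big_add1 big_mkord /=.
transitivity (\sum_(j < r.+1) \sum_(c < r.+1)
   (invmx (Amx r) ord_max j * Amx r j c) *: xvar ^+ c.+1).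
  rewrite exchange_big /=.
  transitivity (\sum_(c < r.+1) (1%:M : 'M[{poly rat}]_r.+1) ord_max c
                 *: xvar ^+ c.+1).
    rewrite (bigD1 ord_max) //= mxE eqxx scale1r big1 ?addr0 // => c neq_c.
    by rewrite mxE eq_sym (negPf neq_c) scale0r.
  apply: eq_bigr => c _; rewrite -scaler_suml; congr (_ *: _).
  by rewrite -(mulVmx (Amx_unit r)) mxE.
apply: eq_bigr => j _; rewrite /gpoly /= inord_val zgenE [in RHS]big_ord_recl.
rewrite expr0 alg_polyC addrAC subrr add0r scaler_sumr.
rewrite (big_ord_widen r.+1 (fun c => invmx (Amx r) ord_max j *:
   (fpoly j c.+1 *: xvar ^+ c.+1))) //= [RHS]big_mkcond /=.
apply: eq_bigr => c _; rewrite mxE ltnS scalerA.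
by case: ifP; rewrite ?mulr0 ?scale0r.
Qed.

(** The f_i are the coefficients of a product of generating polynomials, so substituting b for the
    variable yields the product of the D^{m_j} E. *)
Lemma fsumE n (m : 'I_n -> nat) i :
  fsum m i = (\prod_j \poly_(c < (m j).+2) fpoly (m j) c)`_i.
Proof.
have coefF p c : (\poly_(c < p.+2) fpoly p c)`_c = fpoly p c.
  by rewrite coef_poly ltnS; case: leqP => // /fpoly_gt->.
rewrite coef_prod_ffun [RHS](bigID (fun s : {ffun 'I_n -> 'I_i.+1} =>
  [forall j, (s j <= (m j).+1)%N])) /= [X in _ + X]big1 ?addr0.
  by apply: eq_bigr => s _; apply: eq_bigr => j _; rewrite coefF.
move=> s /andP[_ /forallPn[j]]; rewrite -ltnNge => lt_ms.
by rewrite (bigD1 j) //= coefF fpoly_gt ?mul0r.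
Qed.

Lemma prod_zgen n (m : 'I_n -> nat) :
  \prod_j zgen (m j) =
  \sum_(0 <= i < (weight m + n).+1) fsum m i *: xvar ^+ i.
Proof.
pose Q := \prod_j \poly_(c < (m j).+2) fpoly (m j) c.
have sizeQ : (size Q <= (weight m + n).+1)%N.
  rewrite weightDn.
  apply: (big_ind2 (fun d (p : {poly {poly rat}}) => (size p <= d.+1)%N)).
  - by rewrite size_poly1.
  - move=> d p e q Hp Hq; apply: leq_trans (size_polyMleq _ _) _; lia.
  - by move=> j _; exact: size_poly.
transitivity (Q \Po xvar).
  rewrite rmorph_prod; apply: eq_bigr => j _.
  rewrite /= zgenE poly_def linear_sum; apply: eq_bigr => c _.
  by rewrite linearZ /= comp_Xn_poly.
have -> : Q = \poly_(i < (weight m + n).+1) Q`_i.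
  by apply/polyP => i; rewrite coef_poly; case: ltnP => // ?;
     rewrite nth_default // (leq_trans sizeQ).
rewrite poly_def linear_sum big_mkord; apply: eq_bigr => c _.
by rewrite linearZ /= comp_Xn_poly fsumE.
Qed.

Lemma prod_zgen_expansion n (m : 'I_n -> nat) :
  \prod_j zgen (m j) =
  (fsum m 0)%:P + \sum_(1 <= j < (weight m + n).+1)
                    Fpoly m j *: (zgen j.-1 - (fpoly j.-1 0)%:P).
Proof.
rewrite prod_zgen big_ltn // expr0 alg_polyC; congr (_ + _).
set W := (weight m + n)%N.
transitivity (\sum_(1 <= i < W.+1) \sum_(1 <= j < W.+1 | (j <= i)%N)
    (fsum m i * gpoly i.-1 j) *: (zgen j.-1 - (fpoly j.-1 0)%:P)).
  apply: eq_big_nat => i /andP[i_gt0 le_iW].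
  rewrite -[in xvar ^+ i](prednK i_gt0) xvar_exp scaler_sumr prednK //.
  rewrite (big_nat_widen _ _ W.+1) //=.
  by apply: eq_bigr => j _; rewrite scalerA.
(* With j outermost, the inner sum over i >= j is F_j. *)
rewrite (exchange_big_dep_nat xpredT) //=.
apply: eq_big_nat => j /andP[j_gt0 _].
rewrite /Fpoly scaler_suml [RHS](big_nat_widenl _ 1) //.
Qed.

(** * Degree and parity of f_0 and the F_j *)

Lemma Fpoly_even_deg_le n (m : 'I_n -> nat) :
  let h : {poly rat} := fsum m 0 - \sum_(1 <= j < (weight m + n).+1)
                         Fpoly m j * fpoly j.-1 0 in
  (forall k, (weight m + n < k)%N || odd k -> h`_k = 0) /\
  (forall j k, (0 < j <= weight m + n)%N ->
    (weight m + n < j + k)%N || odd k -> (Fpoly m j)`_k = 0).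
Proof.
move=> h; apply: even_deg_le_expansion.
suff -> : h%:P + \sum_(1 <= j < (weight m + n).+1) Fpoly m j *: zgen j.-1 =
          \prod_j zgen (m j) by apply: even_deg_le_prod.
(* The corrections f_{j-1,0} move into the constant term [h], leaving a combination of the [zgen]
   themselves. *)
rewrite prod_zgen_expansion /h polyCB -addrA [- _ + _]addrC; congr (_ + _).
by rewrite raddf_sum -sumrB; apply: eq_bigr => j _ /=;
   rewrite scalerBr -!mul_polyC polyCM.
Qed.

(** f_0 is the product of the n polynomials f_{m_j,0}, each of degree at most 1. *)
Lemma coef_fsum_0 n (m : 'I_n -> nat) c : (n < c)%N -> (fsum m 0)`_c = 0.
Proof.
move=> lt_nc; apply/nth_default/(leq_trans _ lt_nc).
rewrite fsumE -horner_coef0 horner_prod -[n in n.+1]card_ord -sum1_card.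
apply: (big_ind2 (fun d (p : {poly rat}) => (size p <= d.+1)%N)).
- by rewrite size_poly1.
- move=> d p e q Hp Hq; apply: leq_trans (size_polyMleq _ _) _; lia.
- move=> j _; rewrite horner_coef0 coef_poly /= fpoly_0 -polyC_natr.
  apply: (leq_trans (size_polyD _ _)); rewrite geq_max size_polyN.
  rewrite (leq_trans (size_polyC_leq1 _)) // andbT mul_polyC.
  by rewrite (leq_trans (size_scale_leq _ _)) // size_polyX.
Qed.

(* The parity of the constant term of the expansion says that
   [t/2 * \sum_j F_j] and [f_0] have the same odd part; only [j = 1] reaches
   degree [M + n - 1] on the left, while [f_0] has degree at most [n]. *)
Lemma coef_Fpoly1_top n (m : 'I_n -> nat) l : (0 < weight m)%N ->
  (2 * l).+1 = (weight m + n)%N -> (Fpoly m 1)`_(2 * l) = 0.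
Proof.
move=> W0 El; have [Hh HF] := Fpoly_even_deg_le m.
have := Hh (2 * l).+1; rewrite El orbC -El /= mul2n odd_double -mul2n.
move/(_ isT); rewrite coefB coef_fsum_0; last by lia.
rewrite sub0r coef_sum big_ltn; last by lia.
rewrite [X in _ + X]big_nat big1 ?addr0 => [|j /andP[j1 jW]].
  rewrite fpoly_0 mulrBr mulr1 coefB (HF 1%N (2 * l).+1) /=; try lia.
  rewrite subr0 mulrCA coefCM coefMX /= => /eqP.
  by rewrite oppr_eq0 mulf_eq0 => /orP[//|/eqP].
rewrite fpoly_0 (_ : j.-1 == 0%N = false) ?subr0; last by lia.
by rewrite mulrCA coefCM coefMX /= HF ?mulr0 //; lia.
Qed.

(** * Congruences modulo t^N, standing for identities of power series *)

Definition coef_vanish N (p : {poly rat}) := forall c, (c < N)%N -> p`_c = 0.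

Lemma coef_vanishD N p q :
  coef_vanish N p -> coef_vanish N q -> coef_vanish N (p + q).
Proof. by move=> Hp Hq c Hc; rewrite coefD Hp ?Hq ?addr0. Qed.

Lemma coef_vanishMl N p q : coef_vanish N p -> coef_vanish N (q * p).
Proof.
move=> Hp c Hc; rewrite coefM big1 // => i _.
by rewrite Hp ?mulr0 //; exact: leq_ltn_trans (leq_subr _ _) Hc.
Qed.

Lemma coef_vanish_theta N p : coef_vanish N p -> coef_vanish N (theta p).
Proof. by move=> Hp c Hc; rewrite coef_theta Hp ?mulr0. Qed.

(** Since e = t + ..., division by e costs one power of t. *)
Lemma coef_vanish_cancel N (e p : {poly rat}) : e`_0 = 0 -> e`_1 = 1 ->
  coef_vanish N.+1 (e * p) -> coef_vanish N p.
Proof.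
move=> e0 e1 Hep; elim/ltn_ind => c IHc Hc.
have := Hep c.+1 Hc; rewrite coefM !big_ord_recl /= e0 e1 mul0r add0r mul1r.
rewrite subSS subn0 big1 ?addr0 // => i _.
by rewrite IHc ?mulr0 // /bump /=; have := ltn_ord i; lia.
Qed.

Lemma coef_vanish_prod N n (p q : 'I_n -> {poly rat}) :
  (forall j, coef_vanish N (p j - q j)) ->
  coef_vanish N (\prod_j p j - \prod_j q j).
Proof.
move=> Hpq; apply: (big_ind2 (fun a b => coef_vanish N (a - b))) => //.
  by move=> c _; rewrite subrr coef0.
move=> a1 a2 b1 b2 Ha Hb.
have -> : a1 * b1 - a2 * b2 = b1 * (a1 - a2) + a2 * (b1 - b2) by ring.
by apply: coef_vanishD; apply: coef_vanishMl.
Qed.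

(** * The Bernoulli series and its differential equation *)

Definition bern_coef i : rat := bernoulli i / (i`!)%:R.

Definition bern_poly N : {poly rat} := \poly_(i < N.+1) bern_coef i.

Lemma bern_coef0 : bern_coef 0 = 1.
Proof.
have := bernoulli_egf 1; rewrite /fps_mul !big_ord_recl big_ord0 /=.
by rewrite mulr0 !addr0 invr1 mulr1.
Qed.

Lemma bern_poly_ode N (b := bern_poly N) :
  coef_vanish N (theta b - ((1 - 'X) * b - b ^+ 2)).
Proof.
pose e : {poly rat} := \poly_(i < N.+1) (if i == 0%N then 0 else (i`!)%:R^-1).
have [->|N0] := posnP N; first by [].
apply: (@coef_vanish_cancel N e); rewrite ?coef_poly //=.
  by rewrite ltnS N0 invr1.
have Hr : coef_vanish N.+1 (b * e - 'X).
  move=> c Hc; rewrite coefB coefX -bernoulli_egf; apply/eqP; rewrite subr_eq0.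
  apply/eqP; rewrite coefM; apply: eq_bigr => i _; have := ltn_ord i => Hi.
  by rewrite !coef_poly (leq_trans Hi Hc) (leq_ltn_trans (leq_subr _ _) Hc).
have Hw : coef_vanish N.+1 (theta e - 'X * (1 + e)).
  move=> c Hc; rewrite coefB coef_theta coefXM coefD coef1 !coef_poly Hc.
  case: c Hc => [|c] Hc /=; first by rewrite mul0r subr0.
  rewrite (ltnW Hc); have cS : c.+1%:R != 0 :> rat by rewrite pnatr_eq0.
  case: c Hc cS => [|c] Hc cS /=; first by rewrite mul1r invr1 addr0 subrr.
  rewrite add0r [c.+2`!]factS natrM invfM mulrA divff // mul1r; apply: subrr.
(* Here [e] truncates e^t - 1: differentiate b e = t and eliminate D e by D e = t(1 + e). *)
have -> : e * (theta b - ((1 - 'X) * b - b ^+ 2)) =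
  theta (b * e - 'X) + - b * (theta e - 'X * (1 + e))
   + (b - 1) * (b * e - 'X).
  rewrite [theta (b * e - 'X)]raddfB /= thetaM [theta 'X]/theta derivX; ring.
by do 2?apply: coef_vanishD; [exact: coef_vanish_theta|exact: coef_vanishMl..].
Qed.

(** Agrees with the series t/2 * coth (t/2) up to degree [N]. *)
Definition coth_poly N : {poly rat} := bern_poly N + (1 / 2)%:P * 'X.

Lemma coth_poly_ode N (C := coth_poly N) :
  coef_vanish N (C - C ^+ 2 + (1 / 4%:R) *: 'X^2 - theta C).
Proof.
rewrite sqr_half_X; have thX := theta_half_X; have EX := double_half_X.
set h := (1 / 2)%:P * 'X in thX EX *.
have -> : C - C ^+ 2 + h ^+ 2 - theta C = - 1 * (theta (bern_poly N) -
   ((1 - 'X) * bern_poly N - bern_poly N ^+ 2)).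
  rewrite /C /coth_poly -/h raddfD /= thX EX; ring.
by apply: coef_vanishMl; exact: bern_poly_ode.
Qed.

(** For odd c, each inner product in the coefficient of z^2 has a factor of smaller odd index, so
    the equation reduces to (c + 1) z_c = 0. *)
Lemma coth_poly_odd N c : (c < N)%N -> odd c -> (coth_poly N)`_c = 0.
Proof.
elim/ltn_ind: c => c IHc Hc odd_c.
case: c IHc Hc odd_c => // c IHc Hc odd_c.
have C0 : (coth_poly N)`_0 = 1.
  by rewrite coefD coef_poly bern_coef0 coefCM coefX mulr0 addr0.
have := coth_poly_ode Hc; rewrite coefB coefD coefB coef_theta coefZ coefXn.
rewrite (_ : c.+1 == 2 = false) ?mulr0 ?addr0; last first.
  by case: c odd_c {IHc Hc} => [|[|c]].
rewrite expr2 coefM big_ord_recl big_ord_recr /= subn0 subnn C0.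
rewrite big1 ?add0r => [|i _].
  rewrite mul1r mulr1 /bump /= !add1n => /eqP H; apply/eqP; move: H.
  set x := _`_c.+1; rewrite (_ : _ - _ = - (c.+2%:R * x)); last by ring.
  by rewrite oppr_eq0 mulf_eq0 pnatr_eq0.
have := ltn_ord i; rewrite /bump /= add1n => Hi.
have [odd_i|even_i] := boolP (odd i.+1).
  by rewrite IHc ?mul0r //; lia.
by rewrite [X in _ * X]IHc ?mulr0 //; move: odd_c even_i; lia.
Qed.

(** * Evaluation at z = t/2 * coth (t/2) *)

Lemma zder_horner N (C := coth_poly N) P :
  coef_vanish N ((zder P).[C] - theta P.[C]).
Proof.
have -> : (zder P).[C] - theta P.[C] =
  P^`().[C] * (C - C ^+ 2 + (1 / 4%:R) *: 'X^2 - theta C).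
  rewrite theta_horner /zder hornerD hornerM !(hornerD, hornerN, hornerXn).
  by rewrite hornerX hornerC; ring.
by apply: coef_vanishMl; exact: coth_poly_ode.
Qed.

Lemma zgen_horner N m (C := coth_poly N) :
  coef_vanish N ((zgen m).[C] - iter m theta (C - 1)).
Proof.
elim: m => [|m IHm].
  by rewrite /= hornerD hornerX hornerN hornerC subrr => c _; rewrite coef0.
rewrite -[zgen m.+1]/(zder (zgen m)) iterS.
have -> : (zder (zgen m)).[C] - theta (iter m theta (C - 1)) =
  ((zder (zgen m)).[C] - theta (zgen m).[C])
  + theta ((zgen m).[C] - iter m theta (C - 1)) by rewrite raddfB /=; ring.
by apply: coef_vanishD; [exact: zder_horner|exact: coef_vanish_theta].
Qed.

(** E - b = t/2 - 1 and f_{m0} = D^m (t/2 - 1), so D^m b remains. *)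
Lemma zgen_fpoly_horner N m (C := coth_poly N) :
  coef_vanish N ((zgen m - (fpoly m 0)%:P).[C] - iter m theta (bern_poly N)).
Proof.
have -> : (zgen m - (fpoly m 0)%:P).[C] - iter m theta (bern_poly N) =
          (zgen m).[C] - iter m theta (C - 1); last exact: zgen_horner.
rewrite hornerD hornerN hornerC; apply/polyP => c.
rewrite !coefB !coef_iter_theta fpoly_0 /C /coth_poly !(coefB, coefD) coefCM.
rewrite -polyC_natr coefC coef1 coefX.
case: m => [|m] /=; first by case: c => [|c] /=; ring.
by case: c => [|[|c]] /=; rewrite ?expr1n ?exprS; ring.
Qed.

Lemma coef_eq_vanish N (p q : {poly rat}) c :
  coef_vanish N (p - q) -> (c < N)%N -> p`_c = q`_c.
Proof. by move=> H Hc; apply/eqP; rewrite -subr_eq0 -coefB H. Qed.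

(** * Comparison of the coefficients of t^{2k} *)

Lemma coef_prod_zgen_horner n k (m : 'I_n -> nat) :
  ((\prod_j zgen (m j)).[coth_poly (2 * k).+1])`_(2 * k) =
  2%:R ^+ weight m *
  \sum_(s : {ffun 'I_n -> 'I_k.+1} |
        ((\sum_j s j)%N == k) && [forall j, (1 <= s j)%N])
     (\prod_j (s j)%:R ^+ m j)
       * ((\prod_j bernoulli (2 * s j)%N) / (\prod_j ((2 * s j)`!)%:R)).
Proof.
set N := (2 * k).+1; rewrite horner_prod.
(* [q p] is D^p E, truncated, as a polynomial in t^2; its zero constant term later discards the
   tuples with a zero part. *)
pose q p : {poly rat} := \poly_(s < k.+1)
  (if s == 0%N then 0 else (2 * s)%:R ^+ p * bern_coef (2 * s)).
rewrite (@coef_eq_vanish N _ (\prod_j (q (m j) \Po 'X^2))) //; last first.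
  apply: coef_vanish_prod => j c Hc; rewrite coefB.
  rewrite (coef_eq_vanish (@zgen_horner N (m j)) Hc) coef_iter_theta.
  rewrite coef_comp_poly_Xn // dvdn2; case: ifPn => [even_c|odd_c]; last first.
    rewrite negbK in odd_c; rewrite coefB coth_poly_odd // coef1.
    by case: c odd_c {Hc} => // c _; rewrite !subr0 mulr0.
  have Ec : c = (2 * (c %/ 2))%N by lia.
  move: (c %/ 2)%N Ec Hc => d -> Hd; rewrite [(q _)`_d]coef_poly.
  rewrite ifT; last by lia.
  rewrite coefB coefD coef_poly (leqW Hd) coefCM coefX coef1.
  rewrite muln_eq0 /= (_ : 2 * d == 1 = false)%N; last by lia.
  case: eqP => [->|_]; last by rewrite mulr0 addr0 subr0 subrr.
  by rewrite muln0 bern_coef0 /=; ring.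
have -> : \prod_j (q (m j) \Po 'X^2) = (\prod_j q (m j)) \Po 'X^2.
  by rewrite rmorph_prod.
rewrite coef_comp_poly_Xn // dvdn_mulr // mulKn // coef_prod_ffun mulr_sumr.
rewrite (bigID (fun s : {ffun 'I_n -> 'I_k.+1} => [forall j, (1 <= s j)%N])) /=.
rewrite [X in _ + X]big1 ?addr0 => [|s /andP[_ /forallPn[j]]]; last first.
  by rewrite -eqn0Ngt (bigD1 j) //= coef_poly => ->; rewrite ltn_ord mul0r.
apply: eq_bigr => s /andP[_ /forallP s_gt0].
rewrite -prodrXr -prodf_div -!big_split /=; apply: eq_bigr => j _.
rewrite coef_poly ltn_ord eqn0Ngt s_gt0 /= natrM exprMn /bern_coef.
by rewrite !mulrA.
Qed.

Lemma sum_even_support n (F : nat -> rat) :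
  (forall c, odd c -> F c = 0) ->
  \sum_(c < (2 * n).+1) F c = \sum_(0 <= l < n.+1) F (2 * l)%N.
Proof.
move=> odd_F; elim: n => [|n IHn]; first by rewrite big_ord1 big_nat1.
rewrite big_nat_recr //= -IHn mulnS !big_ord_recr /= [F (2 * n).+1]odd_F.
  by rewrite addr0.
by rewrite /= mul2n odd_double.
Qed.

Lemma coef_prod_zgen_horner_Fpoly n k (m : 'I_n -> nat) : (n < 2 * k)%N ->
  ((\prod_j zgen (m j)).[coth_poly (2 * k).+1])`_(2 * k) =
  \sum_(1 <= j < (weight m + n).+1) \sum_(0 <= l < k.+1)
     acoef m j l * (2 * (k - l))%:R ^+ j.-1 * bern_coef (2 * (k - l)).
Proof.
move=> lt_nk; have [_ HF] := Fpoly_even_deg_le m.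
rewrite prod_zgen_expansion hornerD hornerC horner_sum coefD coef_fsum_0 //.
rewrite add0r coef_sum; apply: eq_big_nat => j Hj; rewrite hornerZ.
set N := (2 * k).+1.
rewrite (@coef_eq_vanish N _ (Fpoly m j * iter j.-1 theta (bern_poly N))) //;
  last by rewrite -mulrBr; apply: coef_vanishMl; exact: zgen_fpoly_horner.
rewrite coefM (@sum_even_support k (fun c => (Fpoly m j)`_c *
   (iter j.-1 theta (bern_poly N))`_(2 * k - c))) => [|c odd_c].
  apply: eq_big_nat => l Hl; rewrite coef_iter_theta coef_poly -mulnBr.
  by rewrite ifT ?mulrA // /N; lia.
by rewrite HF ?odd_c ?orbT ?mul0r.
Qed.

Theorem theorem2p9 (n k : nat) (hn : (0 < n)%N) (hk : (0 < k)%N)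
    (hnk : (n <= k)%N) (m : 'I_n -> nat) :
  \sum_(s : {ffun 'I_n -> 'I_k.+1} |
        ((\sum_j s j)%N == k) && [forall j, (1 <= s j)%N])
     (\prod_j (s j)%:R ^+ m j)
       * ((\prod_j bernoulli (2 * s j)%N) / (\prod_j ((2 * s j)`!)%:R))
  = \sum_(0 <= l < (minn (Tbound m) k).+1)
      (\sum_(1 <= j < (weight m + n - 2 * l).+1)
          acoef m j l / 2%:R ^ ((weight m)%:Z - j%:Z + 1)
            * (k - l)%:R ^+ (j - 1))
      * (bernoulli (2 * k - 2 * l)%N / ((2 * k - 2 * l)`!)%:R).
Proof.
have [_ HF] := Fpoly_even_deg_le m.
have two0 : 2%:R != 0 :> rat by [].
have acoef0 j l : (0 < j <= weight m + n)%N -> (weight m + n < j + 2 * l)%N ->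
    acoef m j l = 0.
  by move=> Hj Hl; rewrite /acoef HF // Hl.
have acoefT j l : (0 < j <= weight m + n)%N -> (Tbound m < l)%N ->
    acoef m j l = 0.
  move=> Hj; rewrite /Tbound gtn_max => /andP[Hl1 Hl2].
  have [|le_jl] := ltnP (weight m + n) (j + 2 * l); first exact: acoef0.
  (* Now l > T forces 2l + 1 = M + n, and M > 0 because 2l >= n. *)
  have -> : j = 1%N by lia.
  by apply: coef_Fpoly1_top; lia.
apply: (mulfI (expf_neq0 (weight m) two0)).
(* From n <= k and k > 0 one gets n < 2k, so f_0 does not contribute. *)
rewrite -coef_prod_zgen_horner coef_prod_zgen_horner_Fpoly; last by lia.
rewrite exchange_big /= mulr_sumr.
rewrite [LHS](big_cat_nat _ (n := (minn (Tbound m) k).+1)) //=; last by lia.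
rewrite [X in _ + X]big_nat [X in _ + X]big1 ?addr0 => [|l Hl]; last first.
  rewrite big_nat big1 // => j Hj; rewrite acoefT ?mul0r //; lia.
apply: eq_big_nat => l Hl; rewrite mulr_suml mulr_sumr.
rewrite [LHS](big_cat_nat _ (n := (weight m + n - 2 * l).+1)) //=; last by lia.
rewrite [X in _ + X]big_nat [X in _ + X]big1 ?addr0 => [|j Hj]; last first.
  rewrite acoef0 ?mul0r //; lia.
apply: eq_big_nat => j /andP[j_gt0 _].
rewrite -mulnBr -/(bern_coef _) natrM exprMn subn1.
(* The exponent may be negative; as j >= 1 it splits into the naturals M and j - 1. *)
have -> : 2%:R ^ ((weight m)%:Z - j%:Z + 1) =
          2%:R ^+ weight m / 2%:R ^+ j.-1 :> rat.
  rewrite (_ : _ - _ + 1 = (weight m)%:Z - j.-1%:Z); last by lia.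
  by rewrite expfzDr // -exprnN.
have := expf_neq0 (weight m) two0; have := expf_neq0 j.-1 two0.
move: (2%:R ^+ weight m) (2%:R ^+ j.-1) => u v v0 u0.
by field; rewrite v0.
Qed.
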